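(* The binary period-doubling sequence $\mathbf{P}_2$ can be uniquely factored into kernel words as follows: $$\mathbf{P}_2=\prod_{i\ge 1}R_i = 0\cdot 1\cdot 000\cdot 10101\cdot 00010001000\cdots .$$
   Context: Let $s_2$ be the morphism of $\{0,1\}^*$ with $s_2(0)=01$, $s_2(1)=00$. The binary period-doubling sequence $\mathbf{P}_2=\lim_{n\to\infty}s_2^n(0)$ is the infinite fixed point of $s_2$ beginning with $0$. For a finite word $u$ beginning with $0$, $0^{-1}u$ denotes $u$ with its first letter deleted. The kernel words of $\mathbf{P}_2$ are the words $R_i$ ($i\ge 0$) defined by $R_0=\varepsilon$ (the empty word), $R_1=0$, $R_2=1$, $R_3=000$, $R_4=10101$, and, for $i>4$, $R_i=0^{-1}s_2(R_{i-1})$ if $i$ is even and $R_i=s_2(R_{i-1})0$ otherwise. The infinite product $\prod_{i\ge1}R_i$ is the concatenation $R_1R_2R_3\cdots$.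
   Formalization: Uniqueness is stated among infinite factorizations into pairwise distinct nonempty kernel words (in any order), since with repetitions allowed it fails: 0 and 1 are themselves kernel words, so the letter-by-letter factorization 0·1·0·0·0·1⋯ is another one. *)

(* Defs.v *)
From mathcomp Require Import all_boot.
Set Implicit Arguments.
Unset Strict Implicit.
Unset Printing Implicit Defensive.

Definition letter := bool.
Notation a0 := (false : letter).
Notation a1 := (true : letter).

Definition word := seq letter.

Definition s2_letter (a : letter) : word :=
  if a then [:: a0; a0] else [:: a0; a1].

Definition s2 (w : word) : word := flatten (map s2_letter w).

(* Convergence of finite words to an infinite word: every finite prefix is
   eventually constant. [take k (w n)] has size at most [k], so the equation
   also forces [k <= size (w n)]. *)
Definition converges (w : nat -> word) (x : nat -> letter) : Prop :=
  forall k, exists N, forall n, N <= n -> take k (w n) = mkseq x k.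

(* The letter of index [k] is read off [s2^k(0)], which has length [2 ^ k > k];
   [P2_lim] and [P2_fixed] below show that this is the limit of [s2^n(0)] and
   the fixed point of [s2] beginning with [a0]. *)
Definition P2 (k : nat) : letter := nth a0 (iter k s2 [:: a0]) k.

(* [behead] is the deletion of the first letter; it is only applied to words
   of the form [s2 u] with [u] nonempty, which begin with [a0]. *)
Fixpoint R (i : nat) : word :=
  match i with
  | 0 => [::]
  | 1 => [:: a0]
  | 2 => [:: a1]
  | 3 => [:: a0; a0; a0]
  | 4 => [:: a1; a0; a1; a0; a1]
  | (_.+4 as j).+1 => if odd j.+1 then rcons (s2 (R j)) a0
                      else behead (s2 (R j))
  end.

Definition infinite_product (u : nat -> word) (x : nat -> letter) : Prop :=
  converges (fun n => flatten (mkseq u n)) x.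

(* The factors must be pairwise distinct: with repetitions allowed, every
   infinite word is a product of the kernel words [R 1 = 0] and [R 2 = 1]. *)
Definition kernel_factorization (u : nat -> word) (x : nat -> letter) : Prop :=
  [/\ forall j, exists2 i, 1 <= i & u j = R i,
      injective u
    & infinite_product u x].

Lemma s2_cat u v : s2 (u ++ v) = s2 u ++ s2 v.
Proof. by rewrite /s2 map_cat flatten_cat. Qed.

Lemma size_s2 u : size (s2 u) = (size u).*2.
Proof.
elim: u => //= a u IHu; rewrite /s2 /= size_cat -/(s2 u) IHu doubleS.
by case: a.
Qed.

Lemma size_iter_s2 n : size (iter n s2 [:: a0]) = 2 ^ n.
Proof. by elim: n => //= n IHn; rewrite size_s2 IHn expnS mul2n. Qed.

Lemma iter_s2_prefix m n :
  m <= n -> exists v, iter n s2 [:: a0] = iter m s2 [:: a0] ++ v.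
Proof.
move=> le_mn; rewrite -(subnK le_mn); elim: (n - m) => [|d [v IHd]].
  by exists [::]; rewrite cats0.
have [v' E] : exists v', iter (d + m).+1 s2 [:: a0]
                         = iter (d + m) s2 [:: a0] ++ v'.
  elim: (d + m) => [|k [v' IHk]]; first by exists [:: a1].
  by exists (s2 v'); rewrite [LHS]iterS {1}IHk s2_cat.
by exists (v ++ v'); rewrite addSn E IHd catA.
Qed.

Lemma nth_iter_s2 n k : k < 2 ^ n -> nth a0 (iter n s2 [:: a0]) k = P2 k.
Proof.
have ltk : k < 2 ^ k by rewrite ltn_expl.
move=> ltkn; case: (leqP k n) => [le|/ltnW le].
  by case: (iter_s2_prefix le) => v ->; rewrite nth_cat size_iter_s2 ltk.
rewrite /P2; case: (iter_s2_prefix le) => v ->.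
by rewrite nth_cat size_iter_s2 ltkn.
Qed.

Lemma P2_lim : converges (fun n => iter n s2 [:: a0]) P2.
Proof.
move=> k; exists k => n le_kn.
have lt : k <= 2 ^ n by rewrite (leq_trans le_kn) // ltnW // ltn_expl.
apply: (@eq_from_nth _ a0) => [|i].
  by rewrite size_takel ?size_iter_s2 // size_mkseq.
rewrite size_takel ?size_iter_s2 // => lt_ik.
by rewrite nth_take // nth_mkseq // nth_iter_s2 // (leq_trans lt_ik).
Qed.

Lemma nth_s2 (u : word) k : k < size u ->
  nth a0 (s2 u) k.*2 = a0 /\ nth a0 (s2 u) k.*2.+1 = ~~ nth a0 u k.
Proof. by elim: u k => // a u IHu [|k] /=; case: a => //= /IHu. Qed.

(* [s2] sends the letter [a] to [:: a0; ~~ a]. *)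
Lemma P2_fixed k : [:: P2 k.*2; P2 k.*2.+1] = s2_letter (P2 k).
Proof.
have ltk : k < 2 ^ k by rewrite ltn_expl.
have lt2 : k.*2.+1 < 2 ^ k.+1 by rewrite expnS mul2n ltn_Sdouble.
rewrite -(nth_iter_s2 lt2) -(nth_iter_s2 (ltnW lt2)) -(nth_iter_s2 ltk) iterS.
have [|-> ->] := @nth_s2 (iter k s2 [:: a0]) k; first by rewrite size_iter_s2.
by case: nth.
Qed.

(* Main.v *)
(** Up to the deleted or appended letter 0, [s2] maps each [R n] to [R n.+1], so
    it maps [R 1 ... R n] to [R 1 ... R n.+1], up to a final 0; hence these products
    are prefixes of the fixed point.  For uniqueness, [R i] begins with 0 iff [i]
    is odd, [R n] is a prefix of [R n.+2], and applying [s2] repeatedly to the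
    clash between [R 0 ++ R 1 = 0] and [R 2 = 1] shows that [R n ++ R n.+1] and
    [R n.+2] always differ in some common position.  So, among the words [R i]
    with [i >= n], only [R n] can start where [R n ++ R n.+1] occurs, while
    the smaller indices are excluded because they are already used. *)
Require Import Defs.
From mathcomp Require Import all_boot.

Set Implicit Arguments.
Unset Strict Implicit.
Unset Printing Implicit Defensive.

Lemma RS n :
  R n.+1 = if odd n then behead (s2 (R n)) else rcons (s2 (R n)) a0.
Proof. by case: n => [|[|[|[|n]]]] //=; case: (odd n). Qed.

Arguments R : simpl never.

Lemma R_head n : exists v, R n.+1 = odd n :: v.
Proof.
elim: n => [|n [v IHv]]; first by exists [::].
rewrite RS IHv /=; case: (odd n) => /=; last by exists (s2 v).
by exists (rcons (a0 :: s2 v) a0).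
Qed.

Lemma s2_R_odd n : odd n -> s2 (R n) = a0 :: R n.+1.
Proof.
case: n => // n odd_n; rewrite [R n.+2]RS odd_n.
by have [v ->] := R_head n; case: (odd n).
Qed.

Lemma RS_even n : ~~ odd n -> R n.+1 = s2 (R n) ++ [:: a0].
Proof. by rewrite RS cats1 => /negbTE ->. Qed.

(** For the even case of [R_prefix2]: the 0 that ends [R n.+1] must reappear after [s2 (R n)] in
    [R n.+3]. *)
Lemma s2_rcons0 v : exists w, s2 v ++ [:: a0] = a0 :: w.
Proof.
case: v => [|a v]; first by exists [::].
by case: a; eexists; rewrite /s2 /=.
Qed.

Lemma R_prefix2 n : exists v, R n.+2 = R n ++ v.
Proof.
elim: n => [|n [v IHv]]; first by exists (R 2).
have := IHv => /(congr1 s2); rewrite s2_cat.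
case: (boolP (odd n)) => odd_n.
  by rewrite s2_R_odd /= ?negbK // s2_R_odd // => -[->]; exists (s2 v).
move=> E; rewrite (RS_even odd_n) (@RS_even n.+2) ?negbK // E.
have [w Ew] := s2_rcons0 v.
by exists w; rewrite -!catA Ew.
Qed.

Lemma R_prefix_double n m : exists v, R (n + m.*2) = R n ++ v.
Proof.
elim: m => [|m [v IHv]]; first by exists [::]; rewrite addn0 cats0.
have [w Ew] := R_prefix2 (n + m.*2).
by exists (v ++ w); rewrite doubleS !addnS Ew IHv catA.
Qed.

(** The position lies inside both words, so a clash survives extending either word to the right. *)
Definition clash (u v : word) :=
  exists k, [/\ k < size u, k < size v & nth a0 u k != nth a0 v k].

Lemma clash_cat u v u' v' : clash u v -> clash (u ++ u') (v ++ v').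
Proof.
case=> k [ku kv neq]; exists k.
by rewrite !size_cat !ltn_addr // !nth_cat ku kv.
Qed.

Lemma clash_behead_s2 u v : clash u v -> clash (behead (s2 u)) (behead (s2 v)).
Proof.
(* Of the two letters that [s2] makes from letter [k], only the second, at [k.*2.+1], depends on it;
   [behead] shifts it to [k.*2]. *)
case=> k [ku kv neq]; exists k.*2.
rewrite !size_behead !size_s2 !nth_behead.
rewrite (nth_s2 ku).2 (nth_s2 kv).2 (inj_eq negb_inj).
by split=> //; rewrite ltn_predRL ltn_Sdouble.
Qed.

Lemma clash_behead u v : clash (behead u) (behead v) -> clash u v.
Proof.
case=> k [ku kv neq]; exists k.+1; rewrite -!nth_behead; split=> //.
  by case: u ku {neq}.
by case: v kv {neq}.
Qed.

Lemma clash_RR n : clash (R n ++ R n.+1) (R n.+2).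
Proof.
elim: n => [|n IHn]; first by exists 0.
have := clash_behead_s2 IHn; rewrite s2_cat.
case: (boolP (odd n)) => odd_n IH.
  (* For odd [n], [s2 (R n ++ R n.+1)] is [R n.+1 ++ R n.+2] with a 0 added in front and the last 0
     missing. *)
  rewrite [R n.+2]RS_even /= ?negbK // catA -[R n.+3]cats0.
  apply: clash_cat; move: IH.
  by rewrite s2_R_odd // [s2 (R n.+2)]s2_R_odd /= ?negbK.
(* For even [n], [R n.+1 ++ R n.+2] equals [s2 (R n ++ R n.+1)]: the 0 ending [R n.+1] is the one
   deleted from [s2 (R n.+1)]. *)
rewrite [R n.+3]RS_even /= ?negbK // -[R n.+1 ++ _]cats0.
apply/clash_cat/clash_behead; rewrite RS_even //.
by rewrite -catA /= -s2_R_odd.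
Qed.

(** If [i - n] is odd, the first letters clash; if it is even and positive, [R n.+2] is a prefix of
    [R i] and [clash_RR] applies. *)
Lemma R_noclash n i : 0 < n -> n <= i ->
  ~ clash (R n ++ R n.+1) (R i) -> i = n.
Proof.
case: n => // n _ le_ni; rewrite -(subnKC le_ni); move: (i - _) => d noclash.
case odd_d: (odd d).
  case: noclash; exists 0.
  have [v ->] := R_head n; have [w Ew] := R_head (n + d).
  by rewrite addSn Ew /= oddD odd_d; split=> //; case: (odd n).
rewrite -(odd_double_half d) odd_d add0n in noclash *.
case: d./2 noclash => [|m] noclash; first by rewrite addn0.
case: noclash; rewrite doubleS -!addSnnS.
have [v ->] := R_prefix_double n.+3 m.
by rewrite -[_ ++ R _]cats0; apply/clash_cat/clash_RR.
Qed.

Lemma R_inj : injective (fun j => R j.+1).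
Proof.
move=> i j; wlog le_ij : i j / i <= j => [hw|] E.
  by case/orP: (leq_total i j) => le; [|symmetry]; apply: hw.
suff: j.+1 = i.+1 by case.
apply: R_noclash => // -[k [_ kj]].
by rewrite -E in kj *; rewrite nth_cat kj eqxx.
Qed.

Definition R_prod n : word := flatten (mkseq (fun j => R j.+1) n).

Lemma flatten_mkseqS (u : nat -> word) n :
  flatten (mkseq u n.+1) = flatten (mkseq u n) ++ u n.
Proof. by rewrite mkseqS flatten_rcons. Qed.

(** Consecutive corrections cancel: the 0 left over at even [n] is the one deleted from
    [s2 (R n.+1)] to form [R n.+2]. *)
Lemma R_prodS n :
  R_prod n.+1 = s2 (R_prod n) ++ (if odd n then [::] else [:: a0]).
Proof.
elim: n => // n IHn.
have prodS m : R_prod m.+1 = R_prod m ++ R m.+1 := flatten_mkseqS _ m.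
rewrite prodS {1}IHn prodS s2_cat -!catA; congr (_ ++ _).
case: (boolP (odd n)) => odd_n /=; first by rewrite odd_n RS_even //= negbK.
by rewrite (negbTE odd_n) -s2_R_odd ?cats0.
Qed.

Lemma P2_even k : P2 k.*2 = a0.
Proof. by have := P2_fixed k; case: (P2 k) => -[]. Qed.

Lemma P2_odd k : P2 k.*2.+1 = ~~ P2 k.
Proof. by have := P2_fixed k; case: (P2 k) => -[]. Qed.

Lemma nth_R_prod n k : k < size (R_prod n) -> nth a0 (R_prod n) k = P2 k.
Proof.
elim: n k => // n IHn k; rewrite R_prodS size_cat nth_cat size_s2.
case: (ltnP k _.*2) => [ltk _|le_k ltk]; last first.
  case: (odd n) ltk => /= ltk; first by rewrite addn0 ltnNge le_k in ltk.
  (* Only the appended 0 lies beyond [s2 (R_prod n)], and its position is even. *)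
  have -> : k = (size (R_prod n)).*2.
    by apply/eqP; rewrite eqn_leq le_k andbT -ltnS; rewrite addn1 in ltk.
  by rewrite subnn P2_even.
rewrite -(odd_double_half k) in ltk *.
case: (odd k) ltk => ltk; rewrite ?add0n ?add1n in ltk *.
  have ltk2 : k./2 < size (R_prod n) by rewrite -ltn_double (ltn_trans _ ltk).
  by rewrite P2_odd (nth_s2 ltk2).2 IHn.
rewrite ltn_double in ltk.
by rewrite P2_even (nth_s2 ltk).1.
Qed.

Lemma leq_size_R_prod n : n <= size (R_prod n).
Proof.
elim: n => // n IHn; rewrite /R_prod flatten_mkseqS size_cat.
have [v ->] := R_head n.
by rewrite addnS ltnS (leq_trans IHn) // leq_addr.
Qed.

Lemma infinite_product_R : infinite_product (fun j => R j.+1) P2.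
Proof.
move=> k; exists k => n le_kn; rewrite -/(R_prod n).
have le_k : k <= size (R_prod n) := leq_trans le_kn (leq_size_R_prod n).
apply: (@eq_from_nth _ a0) => [|i]; first by rewrite size_takel ?size_mkseq.
rewrite size_takel // => lt_ik.
by rewrite nth_take // nth_mkseq // nth_R_prod // (leq_trans lt_ik).
Qed.

Lemma nth_infinite_product u x n k :
    infinite_product u x -> k < size (flatten (mkseq u n)) ->
  nth a0 (flatten (mkseq u n)) k = x k.
Proof.
move=> /(_ k.+1) [N lim_x] ltk; have := lim_x (N + n) (leq_addr _ _).
have [v ->] : exists v,
    flatten (mkseq u (N + n)) = flatten (mkseq u n) ++ v.
  by rewrite /mkseq addnC iotaD map_cat flatten_cat; eexists.
move=> /(congr1 (fun w => nth a0 w k)).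
by rewrite nth_take // nth_cat ltk nth_mkseq.
Qed.

Lemma kernel_factorization_uniq u :
  kernel_factorization u P2 -> forall j, u j = R j.+1.
Proof.
case=> uR u_inj u_P2; elim/ltn_ind => j IHj.
have prod_u : flatten (mkseq u j) = R_prod j.
  by congr flatten; apply/eq_in_map => i; rewrite mem_iota => /IHj.
have [[|i] // _ uj] := uR j.
(* If [i < j], then [u i] is already [R i.+1], against injectivity. *)
have le_ji : j <= i.
  by rewrite leqNgt; apply/negP => lt_ij; move: (lt_ij);
     rewrite -(u_inj _ _ (etrans (IHj i lt_ij) (esym uj))) ltnn.
(* Both [R i.+1] and [R j.+1 ++ R j.+2] occur in [P2] at position [size (R_prod j)], so they cannot
   clash. *)
rewrite uj; congr R; apply: R_noclash => // -[k [kR ki]].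
have nthR w : nth a0 (R_prod j ++ w) (size (R_prod j) + k) = nth a0 w k.
  by rewrite nth_cat ltnNge leq_addr addKn.
have prodSS : R_prod j.+2 = R_prod j ++ (R j.+1 ++ R j.+2).
  by rewrite /R_prod !flatten_mkseqS catA.
have := nth_infinite_product (n := j.+1) (k := size (R_prod j) + k) u_P2.
rewrite flatten_mkseqS prod_u uj nthR size_cat ltn_add2l => /(_ ki) ->.
rewrite -(@nth_R_prod j.+2) prodSS ?nthR ?eqxx //.
by rewrite size_cat ltn_add2l.
Qed.

Theorem proposition2 :
  [/\ kernel_factorization (fun j => R j.+1) P2,
      [seq R i | i <- iota 1 5] =
        [:: [:: a0];
            [:: a1];
            [:: a0; a0; a0];
            [:: a1; a0; a1; a0; a1];
            [:: a0; a0; a0; a1; a0; a0; a0; a1; a0; a0; a0]]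
    & forall u : nat -> word,
        kernel_factorization u P2 -> forall j, u j = R j.+1].
Proof.
split=> //; last exact: kernel_factorization_uniq.
split; [by move=> j; exists j.+1 | exact: R_inj | exact: infinite_product_R].
Qed.
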